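(* Let $G$ be a strongly topological gyrogroup with a symmetric neighborhood base $\mathscr U$ at $0$ and let $H$ be a locally compact metrizable admissible subgyrogroup of $G$ generated from $\mathscr U$. If the quotient space $G/H$ is strictly Fréchet-Urysohn, then $G$ is also strictly Fréchet-Urysohn.
   Context: All topological spaces are assumed to be Hausdorff. A gyrogroup is a set $G$ with a binary operation $\oplus$ such that: (G1) there is a unique identity element $0\in G$ with $0\oplus a=a=a\oplus 0$ for all $a\in G$; (G2) for each $x\in G$ there is a unique inverse $\ominus x\in G$ with $\ominus x\oplus x=0=x\oplus(\ominus x)$; (G3) for all $x,y\in G$ there is an automorphism $\mathrm{gyr}[x,y]$ of $(G,\oplus)$ with $x\oplus(y\oplus z)=(x\oplus y)\oplus \mathrm{gyr}[x,y](z)$ for all $z\in G$; (G4) $\mathrm{gyr}[x\oplus y,y]=\mathrm{gyr}[x,y]$ for all $x,y\in G$. A topological gyrogroup is a gyrogroup with a topology such that $\oplus:G\times G\to G$ is jointly continuous and $x\mapsto\ominus x$ is continuous. A strongly topological gyrogroup with a symmetric neighborhood base $\mathscr U$ at $0$ is a topological gyrogroup $G$ together with a neighborhood base $\mathscr U$ of $0$ such that for every $U\in\mathscr U$: $\ominus U=U$ and $\mathrm{gyr}[x,y](U)=U$ for all $x,y\in G$. A subgyrogroup of $G$ is a nonempty subset $H$ with $\ominus a\in H$ and $a\oplus b\in H$ for all $a,b\in H$; it is an $L$-subgyrogroup if moreover $\mathrm{gyr}[a,h](H)=H$ for all $a\in G$, $h\in H$. A subgyrogroup $H$ of $G$ is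 an admissible subgyrogroup generated from $\mathscr U$ if there is a sequence $\{U_n:n\in\omega\}$ of open symmetric neighborhoods of $0$ with each $U_n\in\mathscr U$, $U_{n+1}\oplus(U_{n+1}\oplus U_{n+1})\subset U_n$ for each $n\in\omega$, and $H=\bigcap_{n\in\omega}U_n$. Such an $H$ is known to be a closed $L$-subgyrogroup of $G$. For an $L$-subgyrogroup $H$, the set $G/H=\{a\oplus H:a\in G\}$ is a partition of $G$; it carries the quotient topology with respect to $\pi:G\to G/H$, $\pi(a)=a\oplus H$ (i.e. $O\subset G/H$ is open iff $\pi^{-1}(O)$ is open in $G$). Subsets such as $H$ carry the subspace topology. A space $X$ is strictly Fréchet-Urysohn if for every $x\in X$ and every sequence $\{A_n\}_{n\in\mathbb N}$ of subsets of $X$ with $x\in\bigcap_{n\in\mathbb N}\overline{A_n}$, there exist $x_n\in A_n$ ($n\in\mathbb N$) such that the sequence $\{x_n\}_n$ converges to $x$. *)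

(* Defs.v *)
From HB Require Import structures.
From mathcomp Require Import all_boot all_order all_algebra.
From mathcomp Require Import all_classical reals topology.

Set Implicit Arguments.
Unset Strict Implicit.
Unset Printing Implicit Defensive.

Import Order.TTheory GRing.Theory Num.Theory.

Local Open Scope classical_set_scope.

Declare Scope gyro_scope.
Delimit Scope gyro_scope with gyro.
Local Open Scope gyro_scope.

Reserved Notation "x ⊕ y" (at level 50, left associativity).
Reserved Notation "⊖ x" (at level 35, right associativity).

(* [gyr] is a field although (G3) only asks for its existence: left
   cancellation holds in any gyrogroup, so the operation determines it.
   The two uniqueness fields are the uniqueness clauses of (G1) and (G2). *)
HB.mixin Record isGyrogroup G := {
  gyradd : G -> G -> G;
  gyr0 : G;
  gyropp : G -> G;
  gyr : G -> G -> G -> G;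
  gyr0add : forall a, gyradd gyr0 a = a;
  gyradd0 : forall a, gyradd a gyr0 = a;
  gyr0_unique : forall e,
    (forall a, gyradd e a = a /\ gyradd a e = a) -> e = gyr0;
  gyrNadd : forall x, gyradd (gyropp x) x = gyr0;
  gyraddN : forall x, gyradd x (gyropp x) = gyr0;
  gyropp_unique : forall x y,
    gyradd y x = gyr0 -> gyradd x y = gyr0 -> y = gyropp x;
  gyr_bij : forall x y, bijective (gyr x y);
  gyr_morph : forall x y, {morph gyr x y : a b / gyradd a b};
  gyraddA : forall x y z,
    gyradd x (gyradd y z) = gyradd (gyradd x y) (gyr x y z);
  gyr_loop : forall x y, gyr (gyradd x y) y = gyr x y
}.

#[short(type="gyrogroupType")]
HB.structure Definition Gyrogroup := { G of isGyrogroup G }.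

Arguments gyr0 {s}.

Notation "x ⊕ y" := (gyradd x y) : gyro_scope.
Notation "⊖ x" := (gyropp x) : gyro_scope.

HB.mixin Record Gyrogroup_isTopGyrogroup G
    & Gyrogroup G & Topological G := {
  gyradd_continuous : continuous (fun p : G * G => p.1 ⊕ p.2);
  gyropp_continuous : continuous (fun x : G => ⊖ x)
}.

#[short(type="topGyrogroupType")]
HB.structure Definition TopGyrogroup :=
  { G of Gyrogroup G & Topological G & Gyrogroup_isTopGyrogroup G }.

(* Members of the base are neighborhoods of 0, not necessarily open. *)
Definition strong_symmetric_base (G : topGyrogroupType) (UU : set (set G)) :=
  [/\ forall U, UU U -> nbhs (gyr0 : G) U,
      forall V, nbhs (gyr0 : G) V -> exists2 U, UU U & U `<=` V &
      forall U, UU U ->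
        [set ⊖ x | x in U] = U /\ forall x y, gyr x y @` U = U].

Definition gyr_setD (G : gyrogroupType) (A B : set G) : set G :=
  [set a ⊕ b | a in A & b in B].

Definition subgyrogroup (G : gyrogroupType) (H : set G) :=
  [/\ H !=set0, forall a, H a -> H (⊖ a) &
      forall a b, H a -> H b -> H (a ⊕ b)].

Definition admissible_subgyrogroup (G : topGyrogroupType)
    (UU : set (set G)) (H : set G) :=
  subgyrogroup H /\
  exists U : nat -> set G,
    [/\ forall n, [/\ UU (U n), open (U n), U n gyr0 &
                      [set ⊖ x | x in U n] = U n],
        forall n, gyr_setD (U n.+1) (gyr_setD (U n.+1) (U n.+1)) `<=` U n &
        H = \bigcap_n U n].

Definition gyr_lcoset (G : gyrogroupType) (H : set G) (a : G) : set G :=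
  [set a ⊕ h | h in H].

Definition coset_space (G : gyrogroupType) (H : set G) : Type :=
  {A : set G | exists a, A = gyr_lcoset H a}.

Section coset_quotient.
Context {G : gyrogroupType} (H : set G).

Definition coset_pi (a : G) : coset_space H :=
  exist _ (gyr_lcoset H a) (ex_intro _ a erefl).

Definition coset_repr (A : coset_space H) : G := projT1 (cid (proj2_sig A)).

Lemma coset_reprK : cancel coset_repr coset_pi.
Proof.
by case=> A hA; apply: eq_exist; rewrite /coset_repr; case: cid => /= a ->.
Qed.

HB.instance Definition _ := isQuotient.Build G (coset_space H) coset_reprK.

End coset_quotient.

(* The library locks \pi; it is propositionally equal to [coset_pi H]. *)
Definition coset_topology (G : topGyrogroupType) (H : set G) :
  topologicalType := quotient_topology (coset_space H).

Definition metrizable (R : realType) (X : topologicalType) :=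
  exists d : X -> X -> R,
    [/\ forall x y, d x y = 0%R <-> x = y,
        forall x y, d x y = d y x,
        forall x y z, (d x z <= d x y + d y z)%R &
        forall x, nbhs x = nbhs_ball_ (fun y e => [set z | (d y z < e)%R]) x].

Definition strictly_frechet_urysohn (X : topologicalType) :=
  forall (x : X) (A : nat -> set X),
    (forall n, closure (A n) x) ->
    exists u : nat -> X, (forall n, A n (u n)) /\ u @ \oo --> x.

(* Main.v *)
(* By homogeneity it suffices to treat sequences A_n accumulating at 0. As H is
   first countable, there are neighborhoods Q_n of 0 in G whose traces on H form
   a base at 0 in H, and neighborhoods W_n of 0 with ⊖W_n ⊕ W_n ⊆ Q_n. The
   images of A_n ∩ W_0 ∩ ... ∩ W_n accumulate at π(0), so there are u_n in these
   sets with π(u_n) → π(0). Given a neighborhood O of 0, choose O' with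
   O' ⊕ O' ⊆ O and m with Q_m ∩ H ⊆ O'. Since π is open, eventually
   u_n = v ⊕ h with v in O' ∩ W_m and h in H; for n ≥ m also
   h = ⊖v ⊕ u_n lies in ⊖W_m ⊕ W_m ⊆ Q_m, so h ∈ O' and u_n ∈ O. *)

Require Import Defs.
From mathcomp Require Import all_boot all_order all_algebra.
From mathcomp Require Import all_classical reals topology.

Import Order.TTheory GRing.Theory Num.Theory.

Local Open Scope classical_set_scope.
Local Open Scope gyro_scope.

Section gyrogroup_theory.
Context {G : gyrogroupType}.
Implicit Types a b x y z : G.

(** By (G3), adding [⊖ a] on the left turns [a ⊕ u] into [gyr (⊖ a) a u], and gyrations are
    injective. *)
Lemma gyradd_injr a : injective (gyradd a).
Proof.
move=> u w auw; apply: (bij_inj (gyr_bij (⊖ a) a)).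
have : ⊖ a ⊕ (a ⊕ u) = ⊖ a ⊕ (a ⊕ w) by rewrite auw.
by rewrite !gyraddA gyrNadd !gyr0add.
Qed.

Lemma gyr0x a z : gyr gyr0 a z = z.
Proof.
by apply: (@gyradd_injr a); have := gyraddA gyr0 a z; rewrite !gyr0add.
Qed.

(** The loop property (G4) rewrites the gyration left over by (G3) as [gyr gyr0 a], which is the
    identity. *)
Lemma gyraddKN a : cancel (gyradd a) (gyradd (⊖ a)).
Proof.
by move=> b; rewrite gyraddA -gyr_loop gyrNadd gyr0add gyr0x.
Qed.

Lemma gyraddNK a : cancel (gyradd (⊖ a)) (gyradd a).
Proof.
by move=> b; rewrite gyraddA -gyr_loop gyraddN gyr0add gyr0x.
Qed.

Lemma subgyrogroup0 (H : set G) : subgyrogroup H -> H gyr0.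
Proof.
by move=> [[a Ha] HN HD]; rewrite -(gyrNadd a); apply: HD => //; exact: HN.
Qed.

(** By (G3), [a ⊕ (h ⊕ k)] equals [(a ⊕ h) ⊕ gyr a h k], and by invariance [gyr a h k] runs through
    all of [H] as [k] does. *)
Lemma gyr_lcoset_shift (H : set G) a h : subgyrogroup H ->
  (forall x y, gyr x y @` H = H) -> H h ->
  gyr_lcoset H (a ⊕ h) = gyr_lcoset H a.
Proof.
move=> [_ HN HD] Hgyr Hh; apply/seteqP; split=> _ [k Hk <-].
- have [k' Hk' <-] : (gyr a h @` H) k by rewrite Hgyr.
  by rewrite -gyraddA; exists (h ⊕ k') => //; exact: HD.
(* Chosen so that (G3) gives [a ⊕ (h ⊕ (⊖ h ⊕ k))], which cancels to [a ⊕ k]. *)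
- exists (gyr a h (⊖ h ⊕ k)).
    by rewrite -[X in X _](Hgyr a h); exists (⊖ h ⊕ k) => //; apply: HD => //;
      exact: HN.
  by rewrite -gyraddA gyraddNK.
Qed.

End gyrogroup_theory.

Section quotient_map.
Context {G : topGyrogroupType} {H : set G}.

Let p (a : G) : coset_topology H := (\pi_(coset_topology H) a)%qT.

Lemma coset_topology_piE a b :
  p a = p b <-> gyr_lcoset H a = gyr_lcoset H b.
Proof.
rewrite /p !unlock; split=> ab; first exact: (congr1 (@proj1_sig _ _) ab).
exact: eq_exist.
Qed.

(** Since [x] and [x ⊕ h] have the same coset, the saturation of [V] is a union of preimages of [V]
    under right translations; their continuity is enough. *)
Lemma coset_topology_pi_open (V : set G) :
  subgyrogroup H -> (forall x y, gyr x y @` H = H) ->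
  open V -> open (p @` V).
Proof.
move=> Hsub Hgyr oV.
have [_ HN HD] := Hsub.
suff -> : open (p @` V) = open (\bigcup_(h in H) ((gyradd^~ h) @^-1` V)).
  apply: bigcup_open => h _; apply: open_comp => // x _.
  apply: (@continuous2_cvg _ _ _ _ _ _ _ _ gyradd) => //.
  - exact: (gyradd_continuous (x, h)).
  - exact: cvg_cst.
rewrite {1}/open /= /quotient_open; congr open; apply/seteqP; split=> x /=.
- move=> [v Vv /coset_topology_piE vx].
  have : gyr_lcoset H v v by exists gyr0; [exact: subgyrogroup0|exact: gyradd0].
  by rewrite vx => -[h Hh xhv]; exists h => //=; rewrite xhv.
- move=> [h Hh Vxh]; exists (x ⊕ h) => //; apply/coset_topology_piE.
  exact: gyr_lcoset_shift.
Qed.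

End quotient_map.

Lemma metrizable_countable_nbhs (R : realType) (X : topologicalType) (x : X) :
  metrizable R X -> exists B : nat -> set X,
    (forall n, nbhs x (B n)) /\
    forall O, nbhs x O -> exists n, B n `<=` O.
Proof.
move=> [d [_ _ _ nbhsd]]; exists (fun n => [set z | d x z < n.+1%:R^-1]%R).
rewrite nbhsd; split=> [n|O [e /= e0 eO]].
  by exists n.+1%:R^-1%R => //=; rewrite invr_gt0 ltr0n.
have [n ne] : exists n : nat, (n.+1%:R^-1 < e)%R.
  (* With [n] the integer part of 1/e, one has 1/e < n+1. *)
  exists (Num.truncn e^-1); rewrite invf_plt ?posrE ?ltr0n//.
  exact: truncnS_gt.
by exists n => z /= dz; apply: eO => /=; exact: lt_trans dz ne.
Qed.

Lemma gyradd_cvg (G : topGyrogroupType) (T : Type) (F : set_system T)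
    {FF : Filter F} (f g : T -> G) (a b : G) :
  f @ F --> a -> g @ F --> b -> f x ⊕ g x @[x --> F] --> a ⊕ b.
Proof.
by apply: continuous2_cvg; exact: (gyradd_continuous (a, b)).
Qed.

Lemma strictly_frechet_urysohn_at0 (G : topGyrogroupType) :
  (forall A : nat -> set G, (forall n, closure (A n) gyr0) ->
    exists u : nat -> G, (forall n, A n (u n)) /\ u @ \oo --> (gyr0 : G)) ->
  strictly_frechet_urysohn G.
Proof.
move=> sfu0 x A clA.
have [|u [Au u0]] := sfu0 (fun n => gyradd x @^-1` A n).
  (* To meet a neighborhood [O] of 0, pull it back to [x], pick a point [y] of [A n] there and
     translate it by [⊖ x]. *)
  move=> n O O0; have : nbhs x (gyradd (⊖ x) @^-1` O).
    have : ⊖ x ⊕ y @[y --> x] --> ⊖ x ⊕ x.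
      by apply: gyradd_cvg; [exact: cvg_cst|exact: cvg_id].
    by rewrite gyrNadd; apply.
  move=> /(clA n)[y [Ay Oy]]; exists (⊖ x ⊕ y); split => //.
  by rewrite /= gyraddNK.
exists (fun n => x ⊕ u n); split => //.
by rewrite -[X in _ --> X](gyradd0 x); apply: gyradd_cvg => //; exact: cvg_cst.
Qed.

Lemma nbhs_gyr0_diff (G : topGyrogroupType) (O : set G) : nbhs gyr0 O ->
  exists2 W : set G, nbhs gyr0 W & forall v w, W v -> W w -> O (⊖ v ⊕ w).
Proof.
move=> O0.
have : ⊖ z.1 ⊕ z.2 @[z --> ((gyr0 : G), (gyr0 : G))] --> ⊖ (gyr0 : G) ⊕ gyr0.
  apply: gyradd_cvg; last exact: cvg_snd.
  by apply: continuous_cvg; [exact: gyropp_continuous|exact: cvg_fst].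
rewrite gyrNadd => /(_ _ O0)[[V W] /= [V0 W0] VW].
exists (V `&` W); first exact: filterI.
by move=> v w [Vv _] [_ Ww]; exact: (VW (v, w)).
Qed.

Lemma nbhs_gyr0_sum (G : topGyrogroupType) (O : set G) : nbhs gyr0 O ->
  exists2 W : set G, nbhs gyr0 W & forall v w, W v -> W w -> O (v ⊕ w).
Proof.
move=> O0.
have := gyradd_continuous ((gyr0 : G), (gyr0 : G)).
rewrite /= /continuous_at /= gyradd0 => /(_ _ O0)[[V W] /= [V0 W0] VW].
exists (V `&` W); first exact: filterI.
by move=> v w [Vv _] [_ Ww]; exact: (VW (v, w)).
Qed.

Lemma nbhs_bigcap_ltn (T : topologicalType) (x : T) (W : nat -> set T) n :
  (forall k, nbhs x (W k)) -> nbhs x (\bigcap_(k < n) W k).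
Proof.
move=> nW; elim: n => [|n IHn].
  by rewrite (_ : \bigcap_(k < 0) W k = setT); [exact: filterT|apply/seteqP].
apply: filterS (filterI IHn (nW n)) => y [Wy Wny] k /=.
by rewrite ltnS leq_eqVlt => /orP[/eqP->//|]; exact: Wy.
Qed.

(** The topological core: [H] enters through its invariance under gyrations and through countably
    many neighborhoods in [G] whose traces control [H] near 0. *)
Lemma strictly_frechet_urysohn_extension (G : topGyrogroupType) (H : set G)
    (Q : nat -> set G) :
  subgyrogroup H -> (forall x y, gyr x y @` H = H) ->
  (forall n, nbhs (gyr0 : G) (Q n)) ->
  (forall O, nbhs (gyr0 : G) O -> exists n, Q n `&` H `<=` O) ->
  strictly_frechet_urysohn (coset_topology H) ->
  strictly_frechet_urysohn G.
Proof.
move=> Hsub Hgyr nQ Qbase sfuGH; apply: strictly_frechet_urysohn_at0 => A clA.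
pose p (a : G) : coset_topology H := (\pi_(coset_topology H) a)%qT.
have pcts : continuous p by exact: pi_continuous.
have [W nW WQ] : exists2 W : nat -> set G, (forall n, nbhs (gyr0 : G) (W n)) &
    forall n v w, W n v -> W n w -> Q n (⊖ v ⊕ w).
  have /choice[W WP] : forall n, exists W : set G, nbhs (gyr0 : G) W /\
      forall v w, W v -> W w -> Q n (⊖ v ⊕ w).
    by move=> n; have [W] := nbhs_gyr0_diff G _ (nQ n); exists W.
  by exists W => n; have [] := WP n.
(* The bound [n.+1] includes [W n], so the chosen point lies in [W m] as soon as [n] is at least
   [m]. *)
have [|y [Ay y0]] := sfuGH (p gyr0)
  (fun n => p @` (A n `&` \bigcap_(k < n.+1) W k)).
  move=> n O /pcts pO.
  have [a [Aa [Wa Oa]]] := clA n _ (filterI (nbhs_bigcap_ltn _ _ _ n.+1 nW) pO).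
  by exists (p a); split => //; exists a.
have /choice[u uP] : forall n, exists a,
    (A n `&` \bigcap_(k < n.+1) W k) a /\ p a = y n.
  by move=> n; have [a ? ?] := Ay n; exists a.
exists u; split=> [n|O /nbhs_gyr0_sum[O' O'0 O'O]].
  by have [[]] := uP n.
have [m QmO'] := Qbase _ O'0.
have VoO : nbhs (gyr0 : G) (O' `&` W m) by exact: filterI.
have pV : nbhs (p gyr0) (p @` (O' `&` W m)°).
  apply: open_nbhs_nbhs; split; last by exists gyr0.
  by apply: coset_topology_pi_open => //; exact: open_interior.
have := y0 _ pV; apply: filterS2 (nbhs_infty_ge m).
move=> n mn [v /interior_subset[O'v Wv]].
have [[_ Wu] <-] := uP n; move=> /coset_topology_piE vu.
(* As [u n] belongs to its own coset, which is that of [v], it has the form [v ⊕ h]. *)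
have : gyr_lcoset H (u n) (u n).
  by exists gyr0; [exact: subgyrogroup0|exact: gyradd0].
rewrite -vu => -[h Hh vh]; rewrite /= -vh.
apply: O'O => //; apply: QmO'; split => //.
by rewrite -(gyraddKN v h) vh; apply: WQ => //; exact: Wu.
Qed.

Theorem theorem4p9 (R : realType) (G : topGyrogroupType)
    (UU : set (set G)) (H : set G)
    (hausG : hausdorff_space G)
    (baseUU : strong_symmetric_base UU)
    (admH : admissible_subgyrogroup UU H)
    (lcH : locally_compact [set: set_type H])
    (metH : metrizable R (set_type H))
    (sfuGH : strictly_frechet_urysohn (coset_topology H)) :
  strictly_frechet_urysohn G.
Proof.
have [Hsub [U [Uprop _ HE]]] := admH.
have [_ _ UUgyr] := baseUU.
have Hgyr x y : gyr x y @` H = H.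
  have gyrU n : gyr x y @` U n = U n.
    by have [UUn _ _ _] := Uprop n; exact: (UUgyr _ UUn).2.
  rewrite HE; apply/seteqP; split=> [_ [z Uz <-] n _|z Uz].
    by rewrite -gyrU; exists z => //; exact: Uz.
  (* The preimages of [z] in the various [U n] must be one and the same point; injectivity of the
     gyration makes them all [g z]. *)
  have [g gK Kg] := gyr_bij x y.
  exists (g z); last exact: Kg.
  move=> n _; have := Uz n I; rewrite -{1}gyrU => -[w Uw <-].
  by rewrite gK.
have /mem_set H0 := subgyrogroup0 H Hsub.
pose h0 : set_type H := exist _ gyr0 H0.
have [B [nB Bbase]] := metrizable_countable_nbhs R _ h0 metH.
(* Subspace topology: each [B n] contains the trace on [H] of an open set of [G] around 0. *)
have /choice[Q QP] : forall n, exists Q : set G,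
    nbhs (gyr0 : G) Q /\ set_val @^-1` Q `<=` B n.
  move=> n; have := nB n; rewrite nbhsE => -[C [[D oD DC] Ch0] CB].
  exists D; split; last by rewrite DC.
  by apply: open_nbhs_nbhs; split => //; move: Ch0; rewrite -DC.
apply: (strictly_frechet_urysohn_extension _ H Q) => //.
  by move=> n; have [] := QP n.
move=> O O0; have : nbhs h0 (set_val @^-1` O) by exact: initial_continuous.
move=> /Bbase[n BO]; exists n => x [Qx /mem_set Hx].
exact: (BO (exist _ x Hx) ((QP n).2 (exist _ x Hx) Qx)).
Qed.
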